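(* Let $\mathcal{H}$ be a complex Hilbert space, let $n$ be a positive integer, let $S_1,\dots,S_n\in\mathcal{B}(\mathcal{H})$, let $q\in(0,1]$, and let $\beta=e^{-\pi \mathrm{i}/(2n)}$ and $\omega=e^{2\pi \mathrm{i}/n}$, where $\mathrm{i}$ is the imaginary unit. Let $\mathbb{S}_{scirc_{\mathrm{i}}}$ be the imaginary skew circulant operator matrix $$\mathbb{S}_{scirc_{\mathrm{i}}}=\begin{bmatrix} S_1 & S_2 & S_3 & \cdots & S_n\\ -\mathrm{i}S_n & S_1 & S_2 & \cdots & S_{n-1}\\ -\mathrm{i}S_{n-1} & -\mathrm{i}S_n & S_1 & \ddots & S_{n-2}\\ \vdots & \vdots & \ddots & \ddots & \vdots\\ -\mathrm{i}S_2 & -\mathrm{i}S_3 & \cdots & -\mathrm{i}S_n & S_1\end{bmatrix}$$ acting on $\bigoplus_{j=1}^n\mathcal{H}$. Then $$\max_{0\le k\le n-1} w_q\left(\sum_{j=1}^n(\beta\omega^k)^{j-1}S_j\right)\le w_q(\mathbb{S}_{scirc_{\mathrm{i}}})\le \frac{q+2\sqrt{1-q^2}}{q}\max_{0\le k\le n-1} w_q\left(\sum_{j=1}^n(\beta\omega^k)^{j-1}S_j\right).$$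
   Context: $\mathcal{B}(\mathcal{K})$ denotes the bounded linear operators on a complex Hilbert space $\mathcal{K}$. An $n\times n$ matrix $[S_{ij}]$ with entries in $\mathcal{B}(\mathcal{H})$ acts on $\bigoplus_{j=1}^n\mathcal{H}$ (with the direct-sum inner product) by $(x_1,\dots,x_n)\mapsto(\sum_j S_{1j}x_j,\dots,\sum_j S_{nj}x_j)$. For $A\in\mathcal{B}(\mathcal{K})$ and a scalar $q$ with $|q|\le 1$, the $q$-numerical range is $W_q(A)=\{\langle Ax,y\rangle: x,y\in\mathcal{K},\ \|x\|=\|y\|=1,\ \langle x,y\rangle=q\}$ and the $q$-numerical radius is $w_q(A)=\sup\{|z|: z\in W_q(A)\}$. In the degenerate case $\dim\mathcal{K}=1$, where $A$ is a scalar $c$ and $W_q(A)$ is empty for $0<q<1$, the convention is $w_q(A)=q|c|$. *)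

(* Defs.v *)
From HB Require Import structures.
From mathcomp Require Import all_boot all_order all_algebra.
From mathcomp Require Import complex.
From mathcomp Require Import all_classical all_reals all_analysis.

Set Implicit Arguments.
Unset Strict Implicit.
Unset Printing Implicit Defensive.

Import Order.TTheory GRing.Theory Num.Theory.
Import numFieldNormedType.Exports.

Local Open Scope classical_set_scope.
Local Open Scope ring_scope.
Local Open Scope complex_scope.

(* Inner products are of type [{dot K for Num.conj}]: positive definite, linear
   in the first argument and conjugate-linear in the second. *)

(* A Hilbert space is a complete normed module over [R[i]] whose norm is induced
   by an inner product satisfying this predicate. *)
Definition induces_norm (R : realType) (H : completeNormedModType R[i])
    (ip : {dot H for Num.conj}) : Prop :=
  forall x : H, `|x| ^+ 2 = ip x x.

Definition bounded_op (R : realType) (V W : normedModType R[i])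
    (f : {linear V -> W}) : Prop :=
  exists M : R, forall x : V, `|f x| <= M%:C * `|x|.

Section DirectSum.
Variables (R : realType) (H : lmodType R[i]) (ip : {dot H for Num.conj}).
Variable n : nat.

Definition dsum_ip (x y : {ffun 'I_n -> H}) : R[i] := \sum_i ip (x i) (y i).

Fact dsum_ip_is_bilinear :
  bilinear_for ( *%R ) (Num.conj \; *%R) dsum_ip.
Proof.
split=> [z a x y | z a x y]; rewrite /dsum_ip /= mulr_sumr -big_split /=.
  by apply: eq_bigr => i _; rewrite !ffunE linearPl.
by apply: eq_bigr => i _; rewrite !ffunE linearPr.
Qed.

HB.instance Definition _ := bilinear_isBilinear.Build R[i]
  {ffun 'I_n -> H} {ffun 'I_n -> H} R[i] ( *%R ) (Num.conj \; *%R)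
  dsum_ip dsum_ip_is_bilinear.

Fact dsum_ip_hermitian x y :
  dsum_ip x y = (-1) ^+ false * Num.conj (dsum_ip y x).
Proof.
rewrite expr0 mul1r /dsum_ip rmorph_sum; apply: eq_bigr => i _.
by rewrite [LHS]hermitian_subproof expr0 mul1r.
Qed.

HB.instance Definition _ := @isHermitianSesquilinear.Build R[i]
  {ffun 'I_n -> H} false Num.conj dsum_ip dsum_ip_hermitian.

Fact dsum_ip_gt0 x : x != 0 -> 0 < dsum_ip x x.
Proof.
move=> x0; rewrite lt_def sumr_ge0 ?andbT; last by move=> i _; exact: dnorm_ge0.
apply: contra x0; rewrite psumr_eq0 => [|i _]; last exact: dnorm_ge0.
move=> /allP xi0; apply/eqP/ffunP => i; rewrite ffunE.
by apply/eqP; rewrite -(dnorm_eq0 ip); apply: (xi0 i); rewrite mem_index_enum.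
Qed.

HB.instance Definition _ := @isDotProduct.Build R[i]
  {ffun 'I_n -> H} dsum_ip dsum_ip_gt0.

Definition opmx_act (M : 'M[H -> H]_n) (x : {ffun 'I_n -> H}) :
    {ffun 'I_n -> H} :=
  [ffun i => \sum_j M i j (x j)].

End DirectSum.

Section QNumericalRange.
Variables (R : realType) (K : lmodType R[i]) (ip : {dot K for Num.conj}).

Definition ip_norm (x : K) : R[i] := sqrtC (ip x x).

Definition qnumrange (q : R[i]) (A : K -> K) : set R[i] :=
  [set z | exists x y : K,
    [/\ ip_norm x = 1, ip_norm y = 1, ip x y = q & z = ip (A x) y]].

Definition one_dimensional : Prop :=
  exists2 e : K, e != 0 & forall x : K, exists c : R[i], x = c *: e.

(* When [K] is one-dimensional and [A] is linear, exactly one [c] satisfies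
   [A = c *: id], so the first supremum is the conventional value [|q| |c|].
   It agrees with the second one when [|q| = 1].  For [K = 0] the range is empty
   and the radius is [sup set0 = 0]. *)
Definition qnumradius (q : R[i]) (A : K -> K) : R :=
  if `[< one_dimensional >] then
    sup [set complex.Re (`|q| * `|c|) | c in [set c | forall x, A x = c *: x]]
  else sup [set complex.Re `|z| | z in qnumrange q A].

End QNumericalRange.

(* The index [j - i] modulo [n]. *)
Definition ord_sub (n : nat) (i j : 'I_n) : 'I_n :=
  Ordinal (ltn_pmod (j + (n - i)) (leq_ltn_trans (leq0n i) (ltn_ord i))).

(* [S j] stands for $S_{j+1}$. *)
Definition iscirc (R : realType) (H : lmodType R[i]) (n : nat)
    (S : 'I_n -> {linear H -> H}) : 'M[H -> H]_n :=
  \matrix_(i, j) (fun x => if (i <= j)%N then S (ord_sub i j) x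
                           else - 'i *: S (ord_sub i j) x).

Definition cexp (R : realType) (z : R[i]) : R[i] :=
  let: a +i* b := z in (expR a)%:C * (cos b +i* sin b).

(* Main.v *)
Require Import Defs.
From HB Require Import structures.
From mathcomp Require Import all_boot all_order all_algebra.
From mathcomp Require Import complex.
From mathcomp Require Import all_classical all_reals all_analysis.
From mathcomp Require Import ring lra zify.

Set Implicit Arguments.
Unset Strict Implicit.
Unset Printing Implicit Defensive.

Import Order.TTheory GRing.Theory Num.Theory.
Import numFieldNormedType.Exports.

Local Open Scope classical_set_scope.
Local Open Scope ring_scope.
Local Open Scope complex_scope.

(** Write lam_k = beta omega^k for the n distinct roots of lam^n = -i, and
    T_k = sum_j lam_k^j S_j (symbol). On the subspace of vectors
    V_k x = (lam_k^i x / sqrt n)_i (mode) the skew circulant matrix acts as T_k: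
    crossing the lower-left corner multiplies a coordinate by lam_k^n = -i,
    exactly the factor put there (iscirc_op_mode). The ranges of the isometries
    V_k are orthogonal and span the direct sum (dsum_ip_mode, sum_mode), so the
    matrix is unitarily equivalent to the direct sum of the T_k.

    The lower bound holds because V_k carries the q-numerical range of T_k into
    that of the matrix (qnumradius_intertwine).

    For the upper bound, write w(A) for the ordinary numerical radius. Three
    inequalities are chained.
    - q w(A) <= w_q(A): if z is a unit vector orthogonal to x, then the two
      vectors q x + s z and q x - s z, with s = sqrt (1 - q^2), both have inner
      product q with x, and <Ax, .> averages to q <Ax, x> over them
      (quad_le_qnumradius).
    - the numerical radius of a direct sum is the largest of those of the
      summands (iscirc_op_nr_bound).
    - w_q(A) <= (q + 2 s) w(A): decompose y as q x + u with u orthogonal to x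
      and of norm s; then <Ax, y> = q <Ax, x> + <Ax, u>, and |<Ax, u>| is at
      most 2 w(A) s by polarization (qnumradius_le).
    Hence w_q of the matrix is at most (q + 2 s) times m / q, where m is the
    maximum of the w_q(T_k).

    The numerical radius itself never appears: it is replaced by the
    quadratic-form bound nr_bound W A, which makes sense on the direct sum
    without any norm there. Boundedness of the S_j enters only through it, to
    make the suprema finite. *)

(** * Real parts of norms and suprema *)

Lemma Re_norm_le (R : realType) (z : R[i]) (a : R) :
  (complex.Re `|z| <= a) = (`|z| <= a%:C).
Proof. by rewrite -[in RHS](RRe_real (normr_real z)) lecR. Qed.

Lemma conjC_real (R : realType) (a : R) : Num.conj a%:C = a%:C.
Proof. exact: conjc_real. Qed.

Lemma normC_real (R : realType) (a : R) : 0 <= a -> `|a%:C| = a%:C.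
Proof. by move=> a0; rewrite ger0_norm // ler0c. Qed.

Lemma sup_le_ge0 (R : realType) (E : set R) (a : R) :
  0 <= a -> ubound E a -> sup E <= a.
Proof.
move=> a0 Ea; have [->|E0] := eqVneq E set0; first by rewrite sup0.
by apply: ge_sup => //; exact/set0P.
Qed.

Lemma sup_ge0_nonneg (R : realType) (E : set R) :
  (forall x, E x -> 0 <= x) -> 0 <= sup E.
Proof.
move=> E0; have [supE|/sup_out->//] := pselect (has_sup E).
have [[x Ex] _] := supE.
by rewrite (le_trans (E0 _ Ex))// sup_upper_bound.
Qed.

(** * The numerical and q-numerical radii of one operator *)

Section OneOperator.
Variables (R : realType) (K : lmodType R[i]) (ip : {dot K for Num.conj}).
Implicit Types (x y z : K) (A : {linear K -> K}) (W q : R).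

Lemma ip_conj x y : ip x y = Num.conj (ip y x).
Proof. by rewrite hermC expr0 mul1r. Qed.

Lemma ip_scalel a x y : ip (a *: x) y = a * ip x y.
Proof. exact: linearZl_LR. Qed.

Lemma ip_scaler a x y : ip x (a *: y) = Num.conj a * ip x y.
Proof. exact: linearZr_LR. Qed.

Lemma ip_addl x y z : ip (x + y) z = ip x z + ip y z.
Proof. exact: linearDl. Qed.

Lemma ip_addr x y z : ip x (y + z) = ip x y + ip x z.
Proof. exact: linearDr. Qed.

Lemma ip_suml (I : finType) (F : I -> K) y :
  ip (\sum_i F i) y = \sum_i ip (F i) y.
Proof. exact: linear_sumlz. Qed.

Lemma ip_norm_eq1 x : ip_norm ip x = 1 <-> ip x x = 1.
Proof.
split=> [|x1]; last by rewrite /ip_norm x1 sqrtC1.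
by move=> /(congr1 (fun c => c ^+ 2)); rewrite sqrtCK expr1n.
Qed.

(** That the numerical radius of [A] is at most [W], in the homogeneous form
    that sums over orthogonal decompositions. *)
Definition nr_bound W (A : K -> K) : Prop :=
  forall x, `|ip (A x) x| <= W%:C * ip x x.

Lemma quad_expand A x z (a : R[i]) :
  ip (A (x + a *: z)) (x + a *: z) =
  ip (A x) x + Num.conj a * ip (A x) z + a * ip (A z) x
  + a * Num.conj a * ip (A z) z.
Proof.
rewrite [A _]linearD [A (a *: _)]linearZ /= !(ip_addl, ip_addr).
by rewrite !(ip_scalel, ip_scaler); ring.
Qed.

(** Polarization expresses 4 <Ax, z> through the four values <Av, v> at
    v = x + a z with a^4 = 1, and the parallelogram law sums their squared
    norms to 4 (|x|^2 + |z|^2). Applied to the identity, it also serves as a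
    weak Cauchy-Schwarz inequality. *)
Lemma polar_bound W A : nr_bound W A ->
  forall x z, `|ip (A x) z| <= W%:C * (ip x x + ip z z).
Proof.
move=> WA x z.
pose g (a : R[i]) := ip (A (x + a *: z)) (x + a *: z).
pose h (a : R[i]) := ip (x + a *: z) (x + a *: z).
have i2 : 'i%R * 'i%R = -1 :> R[i] by rewrite -expr2 sqrCi.
have cI : Num.conj 'i%R = - 'i%R :> R[i] by exact: conjCi.
have cNI : Num.conj (- 'i%R) = 'i%R :> R[i] by rewrite rmorphN/= conjCi opprK.
have c1 : Num.conj 1 = 1 :> R[i] by exact: rmorph1.
have cN1 : Num.conj (- 1) = - 1 :> R[i] by rewrite rmorphN1.
have E : 4 * ip (A x) z = g 1 - g (-1) + 'i%R * g 'i%R - 'i%R * g (- 'i%R).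
  rewrite /g !quad_expand cNI cN1 cI c1.
  move: (ip (A x) x) (ip (A x) z) (ip (A z) x) (ip (A z) z) => p r t s.
  (* Keeping i * i unevaluated makes the second step a polynomial identity;
     the first one uses i * i = -1. *)
  transitivity (2 * r - ('i%R * 'i%R) * 2 * r + (2 + ('i%R * 'i%R) * 2) * t).
    by rewrite i2; ring.
  ring.
have Eh : 4 * (ip x x + ip z z) = h 1 + h (-1) + h 'i%R + h (- 'i%R).
  have E1 := @quad_expand (idfun : {linear K -> K}) x z.
  rewrite /= in E1; rewrite /h !E1 cNI cN1 cI c1.
  by rewrite ['i%R * - _]mulrN [- _ * 'i%R]mulNr i2; ring.
have gh a : `|g a| <= W%:C * h a by exact: WA.
have n4 : 0 < 4 :> R[i] by rewrite ltr0n.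
rewrite -(ler_pM2l n4) mulrCA Eh -[X in X * `|_|](ger0_norm (ltW n4)) -normrM E.
have ni : `|'i%R| = 1 :> R[i] by exact: normCi.
rewrite (le_trans (ler_normB _ _))//= !mulrDr lerD//; last first.
  by rewrite normrM ni mul1r.
rewrite (le_trans (ler_normD _ _))// lerD//; last by rewrite normrM ni mul1r.
by rewrite (le_trans (ler_normB _ _))// lerD.
Qed.

(** Rescaling the second vector to norm one balances the two terms of
    polar_bound; this is where the factor 2 in |A| <= 2 w(A) comes from. *)
Lemma polar_bound_unit W A x y (s : R) : 0 <= W -> 0 <= s -> nr_bound W A ->
  ip x x = 1 -> ip y y = (s ^+ 2)%:C -> `|ip (A x) y| <= (2 * W * s)%:C.
Proof.
move=> W0 s0 WA x1 ys; have [s00|sn0] := eqVneq s 0.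
  move/eqP: ys; rewrite s00 expr0n/= dnorm_eq0 => /eqP->.
  by rewrite linear0r normr0 mulr0.
have sp : 0 < s by rewrite lt_def sn0.
have sC : s%:C != 0 by rewrite -(inj_eq (@complexI R)) in sn0.
have := polar_bound WA x (s%:C^-1 *: y).
rewrite dnormZ ip_scaler x1 ys normrM rmorphV ?unitfE//= conjC_real.
rewrite normfV normC_real// exprVn rmorphXn/= mulVf ?expf_neq0// -[1 + 1]/(2%:R).
rewrite ler_pdivrMl ?ltcR// => /le_trans; apply.
by rewrite -[2]/(2%:R) !rmorphM/= rmorph_nat le_eqVlt; apply/orP; left; apply/eqP; ring.
Qed.

(** Outside dimension one, some vector is not a multiple of [x]; one
    Gram-Schmidt step applied to it gives [z]. *)
Lemma orthogonal_unit x : ip x x = 1 -> ~ one_dimensional K ->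
  exists2 z, ip z z = 1 & ip x z = 0.
Proof.
move=> x1 K1; have xn0 : x != 0.
  by rewrite -(dnorm_eq0 ip) x1 oner_eq0.
have [y yx] : exists y, y - ip y x *: x != 0.
  apply: contrapT => Ky; apply: K1; exists x => // y; exists (ip y x).
  by apply/eqP; rewrite -subr_eq0; apply/negPn/negP => yn; apply: Ky; exists y.
set u := y - _ in yx; have u0 : ip u u != 0 by rewrite dnorm_eq0.
have xu : ip x u = 0.
  rewrite ip_conj /u -scaleNr ip_addl ip_scalel x1 mulr1 subrr.
  exact: conjC0.
exists ((sqrtC (ip u u))^-1 *: u); last by rewrite ip_scaler xu mulr0.
rewrite dnormZ ger0_norm ?invr_ge0 ?sqrt_dnorm_ge0//.
by rewrite exprVn sqrtCK mulVf.
Qed.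

Lemma qnumrange_bounded W A (a : R[i]) : nr_bound W A ->
  has_ubound [set complex.Re `|z| | z in qnumrange ip a A].
Proof.
move=> WA; exists (2 * W) => _ [_ [x [y [+ + _ ->]]] <-].
move=> /ip_norm_eq1 x1 /ip_norm_eq1 y1.
rewrite Re_norm_le (le_trans (polar_bound WA x y))// x1 y1.
by rewrite rmorphM/= rmorph_nat mulrC lexx.
Qed.

Lemma qnumradius_ge0 (a : R[i]) (A : K -> K) : 0 <= qnumradius ip a A.
Proof.
rewrite /qnumradius; case: ifP => _; apply: sup_ge0_nonneg => _ [c _ <-].
  by rewrite -ler0c RRe_real ?mulr_ge0// realM.
by rewrite -ler0c RRe_real.
Qed.

Lemma nr_bound_unit W A :
  (forall x, ip x x = 1 -> `|ip (A x) x| <= W%:C) -> nr_bound W A.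
Proof.
move=> WA x; have [->|x0] := eqVneq x 0.
  by rewrite linear0 !linear0l normr0 mulr0.
have xx : ip x x != 0 by rewrite dnorm_eq0.
pose r := sqrtC (ip x x); have r0 : 0 < r by rewrite sqrtC_gt0 dnorm_gt0.
have xE : x = r *: (r^-1 *: x) by rewrite scalerA mulfV ?scale1r// gt_eqF.
have e1 : ip (r^-1 *: x) (r^-1 *: x) = 1.
  by rewrite dnormZ ger0_norm ?invr_ge0 1?ltW// exprVn sqrtCK mulVf.
rewrite {1 2}xE [A _]linearZ/= ip_scalel ip_scaler mulrA -normCK normrM.
rewrite normrX normr_id (ger0_norm (ltW r0)) sqrtCK mulrC.
by rewrite ler_wpM2r ?dnorm_ge0// WA.
Qed.

Lemma one_dimensional_scalar A x : ip x x = 1 -> one_dimensional K ->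
  exists c, forall y, A y = c *: y.
Proof.
move=> x1 [e e0 Ke]; have [c Ac] := Ke (A e); exists c => y.
by have [d ->] := Ke y; rewrite linearZ/= Ac !scalerA mulrC.
Qed.

Lemma scalar_quad (A : K -> K) c x :
  ip x x = 1 -> (forall y, A y = c *: y) -> c = ip (A x) x.
Proof. by move=> x1 ->; rewrite ip_scalel x1 mulr1. Qed.

Lemma one_dimensional_unit : one_dimensional K -> exists x, ip x x = 1.
Proof.
move=> [e e0 _]; exists ((sqrtC (ip e e))^-1 *: e).
rewrite dnormZ ger0_norm ?invr_ge0 ?sqrt_dnorm_ge0//.
by rewrite exprVn sqrtCK mulVf// dnorm_eq0.
Qed.

(** q w(A) <= w_q(A). In dimension one this is the convention
    w_q(A) = q |c|; otherwise q <Ax, x> is the average of two points of the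
    q-numerical range. *)
Lemma quad_le_qnumradius W A q x : 0 <= q <= 1 -> nr_bound W A ->
  ip x x = 1 -> q%:C * `|ip (A x) x| <= (qnumradius ip q%:C A)%:C.
Proof.
move=> /andP[q0 q1] WA x1; rewrite /qnumradius.
case: ifPn => [/asboolP K1|/asboolPn K1].
  have [c Ac] := one_dimensional_scalar A x1 K1.
  rewrite -(scalar_quad x1 Ac) -[q%:C in leLHS](normC_real q0) -normrM.
  rewrite -Re_norm_le; apply: ub_le_sup; last by exists c => //; rewrite normrM.
  exists (complex.Re `|q%:C * c|) => _ [d Ad <-].
  by rewrite -normrM (scalar_quad x1 Ad) (scalar_quad x1 Ac).
have [z z1 xz] := orthogonal_unit x1 K1.
pose s := Num.sqrt (1 - q ^+ 2).
have s2 : s ^+ 2 = 1 - q ^+ 2.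
  by rewrite sqr_sqrtr// subr_ge0 expr_le1.
(* Both signs of s are covered at once by asking only that t^2 = s^2. *)
have range t : t ^+ 2 = s ^+ 2 ->
    `|q%:C * ip (A x) x + t%:C * ip (A x) z|
      <= (sup [set complex.Re `|z| | z in qnumrange ip q%:C A])%:C.
  move=> ts; rewrite -Re_norm_le; apply: (ub_le_sup (qnumrange_bounded _ WA)).
  exists (q%:C * ip (A x) x + t%:C * ip (A x) z) => //.
  exists x, (q%:C *: x + t%:C *: z); split; first exact/ip_norm_eq1.
  - apply/ip_norm_eq1; rewrite !(ip_addl, ip_addr, ip_scalel, ip_scaler).
    rewrite !conjC_real x1 z1 xz [ip z x]ip_conj xz conjC0 !mulr0 addr0 add0r.
    by rewrite !mulr1 -!rmorphM -rmorphD/= -!expr2 ts s2 subrKC.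
  - by rewrite ip_addr !ip_scaler x1 xz mulr0 addr0 mulr1 conjC_real.
  - by rewrite ip_addr !ip_scaler !conjC_real.
have n2 : 0 < 2 :> R[i] by rewrite ltr0n.
rewrite -(ler_pM2l n2) -{1}(normC_real q0) -normrM.
rewrite -[X in X * `|_|](ger0_norm (ltW n2)) -normrM.
have -> : 2 * (q%:C * ip (A x) x) = (q%:C * ip (A x) x + s%:C * ip (A x) z)
   + (q%:C * ip (A x) x + (- s)%:C * ip (A x) z).
  by rewrite rmorphN/=; ring.
rewrite (le_trans (ler_normD _ _))// mulr_natl mulr2n.
by rewrite lerD// range// sqrrN.
Qed.

(** The first inequality read backwards: a bound on w_q controls the
    numerical radius. The bound [W] only ensures that the supremum defining
    w_q is finite. *)
Lemma qnumradius_nr_bound W A q (m : R) : 0 < q <= 1 -> nr_bound W A ->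
  qnumradius ip q%:C A <= m -> nr_bound (m / q) A.
Proof.
move=> /andP[q0 q1] WA Am; apply: nr_bound_unit => x x1.
rewrite mulrC rmorphM/= fmorphV ler_pdivlMl ?ltcR//.
have q01 : 0 <= q <= 1 by rewrite ltW.
by rewrite (le_trans (quad_le_qnumradius q01 WA x1))// lecR.
Qed.

(** Since <x, y> = q, the component of y orthogonal to x has norm
    sqrt (1 - q^2), so that <Ax, y> splits into a quadratic part and a part
    controlled by polarization. *)
Lemma qnumradius_le W A q : 0 <= W -> 0 <= q <= 1 -> nr_bound W A ->
  qnumradius ip q%:C A <= (q + 2 * Num.sqrt (1 - q ^+ 2)) * W.
Proof.
move=> W0 /andP[q0 q1] WA; set s := Num.sqrt _.
have s0 : 0 <= s by exact: sqrtr_ge0.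
have s2 : s ^+ 2 = 1 - q ^+ 2.
  by rewrite sqr_sqrtr// subr_ge0 expr_le1.
have bound0 : 0 <= (q + 2 * s) * W.
  by rewrite mulr_ge0// addr_ge0// mulr_ge0.
have WA1 x : ip x x = 1 -> `|ip (A x) x| <= W%:C.
  by move=> x1; rewrite (le_trans (WA x))// x1 mulr1.
have qW x : ip x x = 1 -> `|q%:C * ip (A x) x| <= (q * W)%:C.
  move=> x1; rewrite normrM normC_real// rmorphM/= ler_wpM2l ?ler0c//.
  exact: WA1.
rewrite /qnumradius.
case: ifPn => [/asboolP K1|_]; apply: sup_le_ge0 => //.
  move=> _ [c Ac <-]; have [x x1] := one_dimensional_unit K1.
  rewrite -normrM Re_norm_le (scalar_quad x1 Ac) (le_trans (qW _ x1))//.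
  by rewrite lecR mulrDl lerDl !mulr_ge0.
move=> _ [_ [x [y [/ip_norm_eq1 x1 /ip_norm_eq1 y1 xy ->]]] <-].
pose u := y - q%:C *: x; have yE : y = q%:C *: x + u by rewrite subrKC.
have uu : ip u u = (s ^+ 2)%:C.
  rewrite /u -scaleNr !(ip_addl, ip_addr, ip_scalel, ip_scaler).
  rewrite x1 y1 [ip y x]ip_conj xy rmorphN/= !conjC_real s2 rmorphB rmorphXn/=.
  by rewrite rmorph1; ring.
rewrite Re_norm_le yE ip_addr ip_scaler conjC_real.
rewrite (le_trans (ler_normD _ _))//.
have -> : (q + 2 * s) * W = q * W + 2 * W * s by ring.
by rewrite rmorphD/= lerD ?qW//; exact: polar_bound_unit.
Qed.

End OneOperator.

(** An isometric intertwiner maps the q-numerical range of [A] into that of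
    [B]. When [K] is a line and [L] is not, the two radii are given by different
    formulas, and q |c| = q |<Bv, v>| is bounded by quad_le_qnumradius
    instead. *)
Lemma qnumradius_intertwine (R : realType) (K L : lmodType R[i])
    (ipK : {dot K for Num.conj}) (ipL : {dot L for Num.conj})
    (V : {linear K -> L}) (A : {linear K -> K}) (B : {linear L -> L})
    (W q : R) :
  (forall x y, ipL (V x) (V y) = ipK x y) -> (forall x, B (V x) = V (A x)) ->
  nr_bound ipL W B -> 0 <= q <= 1 ->
  qnumradius ipK q%:C A <= qnumradius ipL q%:C B.
Proof.
move=> Viso VA WB q01; have w0 := qnumradius_ge0 ipL q%:C B.
rewrite {1}/qnumradius; case: ifPn => [/asboolP K1|/asboolPn K1].
  apply: sup_le_ge0 => // _ [c Ac <-].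
  have [x x1] := one_dimensional_unit ipK K1.
  have q0 : 0 <= q by case/andP: q01.
  rewrite -normrM Re_norm_le (scalar_quad x1 Ac) -Viso -VA normrM normC_real//.
  by apply: (quad_le_qnumradius _ WB) => //; rewrite Viso.
apply: sup_le_ge0 => // _ [_ [x [y [/ip_norm_eq1 x1 /ip_norm_eq1 y1 xy ->]]] <-].
rewrite /qnumradius; case: ifPn => [/asboolP [e e0 Le]|_].
  (* If [L] is a line then so is its subspace isometric to [K]. *)
  have x0 : x != 0 by rewrite -(dnorm_eq0 ipK) x1 oner_eq0.
  have Vinj z : V z = 0 -> z = 0.
    by move=> Vz; apply/eqP; rewrite -(dnorm_eq0 ipK) -Viso Vz linear0l.
  exfalso; apply: K1; exists x => // z.
  have [a Vx] := Le (V x); have [b Vz] := Le (V z).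
  have a0 : a != 0.
    by apply: contra x0 => /eqP a0; apply/eqP/Vinj; rewrite Vx a0 scale0r.
  exists (b / a); apply/eqP; rewrite -subr_eq0; apply/eqP/Vinj.
  by rewrite linearB linearZ/= Vx Vz scalerA divfK// subrr.
apply: (ub_le_sup (qnumrange_bounded _ WB)).
exists (ipK (A x) y) => //; exists (V x), (V y).
by split; rewrite ?VA ?Viso//; apply/ip_norm_eq1; rewrite Viso.
Qed.

(** * The skew circulant operator matrix and its symbol *)

Section Operators.
Variables (R : realType) (H : lmodType R[i]) (n : nat).
Variable S : 'I_n -> {linear H -> H}.

Definition symbol (z : R[i]) (x : H) : H := \sum_(j < n) z ^+ j *: S j x.

Fact symbol_is_linear z : linear (symbol z).
Proof.
move=> a x y; rewrite /symbol scaler_sumr -big_split; apply: eq_bigr => j _ /=.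
by rewrite linearP scalerDr !scalerA mulrC.
Qed.

HB.instance Definition _ z :=
  GRing.isLinear.Build R[i] H H *:%R (symbol z) (symbol_is_linear z).

Definition iscirc_op : {ffun 'I_n -> H} -> {ffun 'I_n -> H} :=
  opmx_act (iscirc S).

Fact iscirc_op_is_linear : linear iscirc_op.
Proof.
move=> a x y; apply/ffunP => i; rewrite !ffunE scaler_sumr -big_split.
apply: eq_bigr => j _ /=; rewrite !mxE !ffunE.
by case: ifP => _; rewrite linearP// scalerDr !scalerA mulrC.
Qed.

HB.instance Definition _ := GRing.isLinear.Build R[i] {ffun 'I_n -> H}
  {ffun 'I_n -> H} *:%R iscirc_op iscirc_op_is_linear.

End Operators.

(** * Diagonalization by the roots of -i *)

Section Diagonalization.
Variables (R : realType) (H : lmodType R[i]) (ip : {dot H for Num.conj}).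
Variables (n : nat) (n_gt0 : (0 < n)%N) (S : 'I_n -> {linear H -> H}).
Variable lam : 'I_n -> R[i].
Hypothesis lam_inj : injective lam.
Hypothesis lam_exp : forall k, lam k ^+ n = - 'i%R.

Let c : R[i] := (sqrtC n%:R)^-1.

Let c_conj : Num.conj c = c.
Proof.
by apply/CrealP; rewrite ger0_real// invr_ge0 sqrtC_ge0 ler0n.
Qed.

Let c_sqr : c * c * n%:R = 1.
Proof.
by rewrite -expr2 exprVn sqrtCK mulVf// pnatr_eq0 -lt0n.
Qed.

Let lam_conj k : lam k * Num.conj (lam k) = 1.
Proof.
have : `|lam k| ^+ n = 1 by rewrite -normrX lam_exp normrN normCi.
move/eqP; rewrite pexpr_eq1// => /eqP l1.
by rewrite -normCK l1 expr1n.
Qed.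

(** The ratio z of two roots of -i satisfies z^n = 1, so its geometric sum
    vanishes unless z = 1. *)
Lemma lam_sum k l :
  \sum_(i < n) lam k ^+ i * Num.conj (lam l ^+ i) = n%:R *+ (k == l).
Proof.
transitivity (\sum_(i < n) (lam k * Num.conj (lam l)) ^+ i).
  by apply: eq_bigr => i _; rewrite rmorphXn exprMn.
have [->|kl] := eqVneq k l.
  under eq_bigr do rewrite lam_conj expr1n.
  by rewrite sumr_const card_ord.
have z1 : lam k * Num.conj (lam l) - 1 != 0.
  apply: contra kl; rewrite subr_eq0 => /eqP kl; apply/eqP/lam_inj.
  by rewrite -[RHS]mul1r -kl -mulrA [_ * lam l]mulrC lam_conj mulr1.
apply: (mulfI z1); rewrite mulr0 -subrX1 exprMn -rmorphXn/= !lam_exp.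
by rewrite rmorphN/= conjCi opprK mulNr -expr2 sqrCi opprK subrr.
Qed.

(** A one-sided inverse of a square matrix is two-sided, so orthogonality of
    the rows of the normalized matrix of powers gives that of its columns. *)
Lemma lam_sum_dual (i j : 'I_n) :
  \sum_(k < n) lam k ^+ i * Num.conj (lam k ^+ j) = n%:R *+ (i == j).
Proof.
pose F : 'M[R[i]]_n := \matrix_(k, i) (c * lam k ^+ i).
pose G : 'M[R[i]]_n := \matrix_(i, k) (c * Num.conj (lam k ^+ i)).
have FG : F *m G = 1%:M.
  apply/matrixP => k l; rewrite !mxE.
  under eq_bigr do rewrite !mxE mulrACA.
  by rewrite -mulr_sumr lam_sum mulrnAr c_sqr.
move/matrixP: (mulmx1C FG) => /(_ j i); rewrite !mxE.
under eq_bigr do rewrite !mxE mulrACA [X in _ * X]mulrC.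
rewrite -mulr_sumr => /(congr1 ( *%R n%:R)); rewrite mulrA [n%:R * _]mulrC.
by rewrite c_sqr mul1r => ->; rewrite mulrnAr mulr1 eq_sym.
Qed.

Definition mode (k : 'I_n) (x : H) : {ffun 'I_n -> H} :=
  [ffun i => (c * lam k ^+ nat_of_ord i) *: x].

Fact mode_is_linear k : linear (mode k).
Proof.
move=> a x y; apply/ffunP => i; rewrite !ffunE scalerDr !scalerA.
by rewrite [_ * a]mulrC.
Qed.

HB.instance Definition _ k := GRing.isLinear.Build R[i] H {ffun 'I_n -> H}
  *:%R (mode k) (mode_is_linear k).

(** The adjoint of [mode k]. *)
Definition mode_coef (k : 'I_n) (x : {ffun 'I_n -> H}) : H :=
  \sum_(i < n) (c * Num.conj (lam k ^+ i)) *: x i.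

Lemma dsum_ip_mode k l x y :
  dsum_ip ip (mode k x) (mode l y) = ip x y *+ (k == l).
Proof.
rewrite /dsum_ip.
under eq_bigr => i _ do rewrite !ffunE ip_scalel ip_scaler mulrA rmorphM/=
   [Num.conj c]c_conj mulrACA.
rewrite -mulr_suml -mulr_sumr lam_sum mulrnAr c_sqr mulrnAl.
by rewrite mul1r.
Qed.

Lemma sum_mode x : \sum_k mode k (mode_coef k x) = x.
Proof.
apply/ffunP => i; rewrite sum_ffunE.
under eq_bigr => k _ do rewrite ffunE scaler_sumr.
rewrite exchange_big/= (bigD1 i)//= [X in _ + X]big1 ?addr0 => [|j ji].
  under eq_bigr do rewrite scalerA mulrACA.
  by rewrite -scaler_suml -mulr_sumr lam_sum_dual eqxx c_sqr scale1r.
under eq_bigr do rewrite scalerA mulrACA.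
rewrite -scaler_suml -mulr_sumr lam_sum_dual eq_sym (negPf ji) mulr0n.
by rewrite mulr0 scale0r.
Qed.

Lemma ord_sub_inj (i : 'I_n) : injective (ord_sub i).
Proof.
move=> j l /(congr1 val) /= /eqP; rewrite eqn_modDr !modn_small//.
by move=> /eqP; exact: val_inj.
Qed.

(** The entry in row i and column j carries S_(j-i), with the index taken
    modulo n. Above the diagonal lam^j = lam^i lam^(j-i); below it, the factor
    -i = lam^n restores lam^j to lam^i lam^(n+j-i). *)
Lemma iscirc_op_mode k x : iscirc_op S (mode k x) = mode k (symbol S (lam k) x).
Proof.
apply/ffunP => i; rewrite !ffunE scaler_sumr.
rewrite [RHS](reindex_inj (@ord_sub_inj i)); apply: eq_bigr => j _ /=.
rewrite !mxE ffunE; case: leqP => ij; rewrite linearZ/= !scalerA; congr (_ *: _).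
  rewrite -mulrA -exprD; congr (_ * lam k ^+ _).
  have -> : (j + (n - i) = n + (j - i))%N by have := ltn_ord i; lia.
  by rewrite modnDl modn_small; have := ltn_ord j; lia.
rewrite -(lam_exp k) mulrCA -mulrA -!exprD; congr (_ * lam k ^+ _).
rewrite modn_small; last by have := ltn_ord i; lia.
by have := ltn_ord i; lia.
Qed.

Lemma dsum_ip_sum_mode (u v : 'I_n -> H) :
  dsum_ip ip (\sum_k mode k (u k)) (\sum_k mode k (v k)) =
  \sum_k ip (u k) (v k).
Proof.
rewrite linear_sumlz; apply: eq_bigr => k _.
rewrite linear_sumr (bigD1 k)//= dsum_ip_mode eqxx big1 ?addr0// => l lk.
by rewrite dsum_ip_mode eq_sym (negPf lk).
Qed.

(** In the coordinates u_k of x along the modes, <Mx, x> is the sum of the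
    <T_k u_k, u_k> and <x, x> that of the <u_k, u_k>, so a common bound for the
    T_k passes to M. *)
Lemma iscirc_op_nr_bound W :
  (forall k, nr_bound ip W (symbol S (lam k))) ->
  nr_bound (dsum_ip ip (n := n)) W (iscirc_op S).
Proof.
move=> SW x.
have Sx : iscirc_op S x = \sum_k mode k (symbol S (lam k) (mode_coef k x)).
  rewrite -[in LHS](sum_mode x) linear_sum; apply: eq_bigr => k _.
  exact: iscirc_op_mode.
have ipx (u : 'I_n -> H) :
    dsum_ip ip (\sum_k mode k (u k)) x = \sum_k ip (u k) (mode_coef k x).
  by rewrite -[X in dsum_ip _ _ X]sum_mode dsum_ip_sum_mode.
have xx : dsum_ip ip x x = \sum_k ip (mode_coef k x) (mode_coef k x).
  by rewrite -ipx sum_mode.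
rewrite /= Sx xx ipx mulr_sumr (le_trans (ler_norm_sum _ _ _))//.
by apply: ler_sum => k _; exact: SW.
Qed.

End Diagonalization.

(** * The numbers beta omega^k *)

Section Roots.
Variable R : realType.

Definition cis (t : R) : R[i] := cos t +i* sin t.

Lemma cexp_imag (t : R) : cexp (t%:C * 'i%R) = cis t.
Proof.
have -> : t%:C * 'i%R = 0 +i* t.
  by rewrite (_ : 'i%R = 0 +i* 1 :> R[i])//; simpc.
by rewrite /cexp expR0 mul1r.
Qed.

Lemma cisD (s t : R) : cis (s + t) = cis s * cis t.
Proof. by rewrite /cis cosD sinD [X in _ +i* X]addrC; simpc. Qed.

Lemma cisX (t : R) m : cis t ^+ m = cis (m%:R * t).
Proof.
elim: m => [|m IH]; first by rewrite expr0 mul0r /cis cos0 sin0.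
by rewrite exprS IH -cisD -natr1 mulrDl mul1r addrC.
Qed.

Lemma cis_neq0 (t : R) : cis t != 0.
Proof.
apply/negP => /eqP[ct st]; have := cos2Dsin2 t.
by rewrite ct st expr0n addr0 => /esym/eqP; rewrite oner_eq0.
Qed.

(** cos t = 1 - 2 sin^2 (t/2), and the half angle lies in (0, pi). *)
Lemma cis_neq1 (t : R) : 0 < t < 2 * pi -> cis t != 1.
Proof.
move=> /andP[t0 tpi]; apply/negP => /eqP[ct _].
have s0 : 0 < sin (t / 2) by apply: sin_gt0_pi; lra.
have := cos_mulr2n (t / 2); have := cos2Dsin2 (t / 2).
have -> : t / 2 *+ 2 = t by rewrite -mulr_natr divfK// pnatr_eq0.
rewrite ct mulr2n; have := exprn_gt0 2 s0; lra.
Qed.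

Variable n : nat.
Hypothesis n_gt0 : (0 < n)%N.

Let n_neq0 : n%:R != 0 :> R.
Proof. by rewrite pnatr_eq0 -lt0n. Qed.

Lemma cexp_beta :
  cexp (- (pi%:C * 'i%R) / (2 * n%:R)) = cis (- (pi / (2 * n%:R))).
Proof.
rewrite -cexp_imag; congr cexp.
by rewrite rmorphN/= rmorphM/= fmorphV rmorphM/= !rmorph_nat; ring.
Qed.

Lemma cexp_omega : cexp (2 * pi%:C * 'i%R / n%:R) = cis (2 * pi / n%:R).
Proof.
rewrite -cexp_imag; congr cexp.
by rewrite !rmorphM/= fmorphV !rmorph_nat; ring.
Qed.

Let b := cis (- (pi / (2 * n%:R))).
Let w := cis (2 * pi / n%:R).

Lemma beta_omega_exp (k : nat) : (b * w ^+ k) ^+ n = - 'i%R.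
Proof.
have w1 : w ^+ n = 1.
  by rewrite /w cisX mulrC divfK// mulr_natl /cis cos2pi sin2pi.
rewrite exprMn -exprM mulnC exprM w1 expr1n mulr1 /b cisX.
have -> : n%:R * - (pi / (2 * n%:R)) = - (pi / 2) :> R by field.
rewrite /cis cosN sinN cos_pihalf sin_pihalf.
by apply/eqP; rewrite eq_complex /= oppr0 !eqxx.
Qed.

Lemma beta_omega_inj : injective (fun k : 'I_n => b * w ^+ k).
Proof.
have wlt (k l : 'I_n) : (k < l)%N -> w ^+ k != w ^+ l.
  move=> kl; rewrite -(subnKC (ltnW kl)) exprD -[X in X == _]mulr1.
  rewrite (inj_eq (mulfI _)) ?expf_neq0 ?cis_neq0// eq_sym cisX.
  have d0 : 0 < (l - k)%:R :> R by rewrite ltr0n subn_gt0.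
  have dn : (l - k)%:R < n%:R :> R by rewrite ltr_nat; have := ltn_ord l; lia.
  have n0 : 0 < n%:R :> R by rewrite ltr0n.
  apply: cis_neq1; rewrite mulrA !mulr_gt0 ?invr_gt0 ?pi_gt0//=.
  by rewrite ltr_pdivrMr// mulrC ltr_pM2l// mulr_gt0 ?pi_gt0.
move=> k l /(mulfI (cis_neq0 _)) kl; apply/val_inj.
case: (ltngtP k l) => // /wlt; rewrite kl ?eqxx//.
Qed.

End Roots.

(** * The q-numerical radius of the skew circulant *)

Lemma nr_bound_sum_scale (R : realType) (K : lmodType R[i])
    (ip : {dot K for Num.conj}) (n : nat) (a : 'I_n -> R[i]) (M : 'I_n -> R)
    (A : 'I_n -> {linear K -> K}) :
  (forall j, nr_bound ip (M j) (A j)) ->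
  nr_bound ip (\sum_j complex.Re `|a j| * M j) (fun x => \sum_j a j *: A j x).
Proof.
move=> AM x; rewrite ip_suml rmorph_sum mulr_suml.
rewrite (le_trans (ler_norm_sum _ _ _))//; apply: ler_sum => j _.
rewrite ip_scalel normrM -[X in X * `|_|](RRe_real (normr_real (a j))).
rewrite (rmorphM (real_complex R)) -mulrA; apply: ler_wpM2l; last exact: AM.
by rewrite RRe_real.
Qed.

(** polar_bound for the identity gives
    |<Ax, x>| <= |Ax|^2 + |x|^2 <= (M^2 + 1) |x|^2. *)
Lemma bounded_op_nr_bound (R : realType) (H : completeNormedModType R[i])
    (ip : {dot H for Num.conj}) (A : {linear H -> H}) :
  induces_norm ip -> bounded_op A -> exists M, nr_bound ip M A.
Proof.
move=> Hip [M AM]; exists (M ^+ 2 + 1) => x.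
have id1 : nr_bound ip 1 (idfun : {linear H -> H}).
  by move=> y; rewrite mul1r ger0_norm ?dnorm_ge0.
rewrite (le_trans (polar_bound id1 (A x) x))//= mul1r -!Hip.
rewrite rmorphD rmorphXn/= rmorph1 mulrDl mul1r lerD2r -exprMn.
by rewrite lerXn2r ?nnegrE// (le_trans _ (AM x)).
Qed.

Theorem theorem4p5 (R : realType) (H : completeNormedModType R[i])
    (ip : {dot H for Num.conj}) (Hip : induces_norm ip)
    (n : nat) (n_gt0 : (0 < n)%N)
    (S : 'I_n -> {linear H -> H}) (S_bounded : forall j, bounded_op (S j))
    (q : R) (q_gt0 : 0 < q) (q_le1 : q <= 1) :
  let beta : R[i] := cexp (- (pi%:C * 'i) / (2 * n%:R)) in
  let omega : R[i] := cexp (2 * pi%:C * 'i / n%:R) in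
  let m : R := \big[Num.max/0]_(k < n)
    qnumradius ip q%:C
      (fun x => \sum_(j < n) (beta * omega ^+ k) ^+ j *: S j x) in
  let w : R := qnumradius (dsum_ip ip (n := n)) q%:C (opmx_act (iscirc S)) in
  m <= w /\ w <= (q + 2 * Num.sqrt (1 - q ^+ 2)) / q * m.
Proof.
move=> beta omega m w.
pose lam (k : 'I_n) := beta * omega ^+ k.
have lam_inj : injective lam.
  by rewrite /lam /beta /omega cexp_beta cexp_omega; exact: beta_omega_inj.
have lam_exp k : lam k ^+ n = - 'i%R.
  by rewrite /lam /beta /omega cexp_beta cexp_omega; exact: beta_omega_exp.
have q01 : 0 <= q <= 1 by rewrite ltW.
have [M SM] := choice (fun j => bounded_op_nr_bound Hip (S_bounded j)).
have symM k := nr_bound_sum_scale (fun j : 'I_n => lam k ^+ j) SM.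
have symm k : qnumradius ip q%:C (symbol S (lam k)) <= m.
  exact: (le_bigmax 0 (fun k => qnumradius ip q%:C (symbol S (lam k))) k).
have m0 : 0 <= m.
  exact: le_trans (qnumradius_ge0 _ _ _) (symm (Ordinal n_gt0)).
have symW k : nr_bound ip (m / q) (symbol S (lam k)).
  apply: (qnumradius_nr_bound (A := symbol S (lam k)) _ (symM k) (symm k)).
  by rewrite q_gt0.
have opW := iscirc_op_nr_bound n_gt0 lam_inj lam_exp symW.
split.
  apply: bigmax_le => [|k _]; first exact: qnumradius_ge0.
  apply: (@qnumradius_intertwine R H {ffun 'I_n -> H} ip (dsum_ip ip (n := n))
    (mode lam k) (symbol S (lam k)) (iscirc_op S) (m / q)) => //.
    by move=> x y; rewrite /= dsum_ip_mode// eqxx.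
  by move=> x; exact: iscirc_op_mode.
rewrite -mulrA [q^-1 * m]mulrC.
apply: (qnumradius_le (A := iscirc_op S) _ q01 opW).
by rewrite divr_ge0// ltW.
Qed.
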